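(* Let $[\widehat{0},\widehat{1}]$ be any Eulerian poset of rank $n+1$, and let $c_0,c_1,\ldots,c_{\lfloor n/2\rfloor}$ be integers. Then $$ \operatorname{t}([\widehat{0},\widehat{1}),x)=\sum_{k=0}^{\left\lfloor n/2\right\rfloor} c_k\, t_{n-2k}(x) $$ holds if and only if $$ g([\widehat{0},\widehat{1}),x)=\sum_{k=0}^{\left\lfloor n/2\right\rfloor} c_k\, x^k . $$
   Context: A graded poset is a finite poset with a unique minimum $\widehat{0}$, a unique maximum $\widehat{1}$ and a rank function $\rho:P\to\mathbb{N}$ with $\rho(\widehat{0})=0$ and $\rho(y)=\rho(x)+1$ whenever $y$ covers $x$; its rank is $\rho(\widehat{1})$. It is Eulerian if $\sum_{z\in[u,v]}(-1)^{\rho(z)}=0$ for all $u<v$. Write $[\widehat{0},p)=\{q: q<p\}$. Stanley's toric polynomials: $f(\emptyset,x)=g(\emptyset,x)=1$ ($\emptyset$ being $[\widehat{0},\widehat{1})$ for the Eulerian poset of rank $0$), and for an Eulerian poset of rank at least $1$, $$f([\widehat{0},\widehat{1}),x)=\sum_{p\in[\widehat{0},\widehat{1})} g([\widehat{0},p),x)(x-1)^{\rho(\widehat{1})-1-\rho(p)},$$ $$g([\widehat{0},\widehat{1}),x)=\sum_{i=0}^{\lfloor(\rho(\widehat{1})-1)/2\rfloor}\left([x^i]f([\widehat{0},\widehat{1}),x)-[x^{i-1}]f([\widehat{0},\widehat{1}),x)\right)x^i.$$ By a theorem of Stanley, if the rank is $n+1$ then $f([\widehat{0},\widehat{1}),x)$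 has degree $n$ and satisfies $x^nf([\widehat{0},\widehat{1}),1/x)=f([\widehat{0},\widehat{1}),x)$. Short toric polynomial: for an Eulerian poset of rank $n+1$, $\operatorname{t}([\widehat{0},\widehat{1}),x)$ is the unique polynomial $q(x)$ of degree $n$ with $q(x)=(-1)^nq(-x)$ and $f([\widehat{0},\widehat{1}),x)=x^{n/2}\left(q(\sqrt{x})+q(1/\sqrt{x})-q(0)\right)$; equivalently, it is obtained from $x^{n}f([\widehat{0},\widehat{1}),x^{-2})$ by discarding all terms of negative degree. $t_m(x)$ denotes the short toric polynomial of the Boolean algebra of rank $m+1$ (with its maximum removed); explicitly $t_m(x)=\sum_{k=0}^{\lfloor m/2\rfloor}x^{m-2k}$ for $m\geq0$. *)

(* Defs.v *)
From HB Require Import structures.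
From mathcomp Require Import all_boot all_order all_algebra.

Set Implicit Arguments.
Unset Strict Implicit.
Unset Printing Implicit Defensive.

Import Order.TTheory GRing.Theory.
Import Order.DefaultSetSubsetOrder.
Local Open Scope ring_scope.

Definition covers (d : Order.disp_t) (T : finTBPOrderType d) (x y : T) : Prop :=
  (x < y)%O /\ forall z : T, ~ ((x < z)%O /\ (z < y)%O).

Definition rank_function (d : Order.disp_t) (T : finTBPOrderType d)
    (rho : T -> nat) : Prop :=
  rho \bot%O = 0%N /\ forall x y : T, covers x y -> rho y = (rho x).+1.

(* The posets below are pairs [T], [rho]; the rank of the poset is
   [rho \top]. *)
Definition eulerian (d : Order.disp_t) (T : finTBPOrderType d)
    (rho : T -> nat) : Prop :=
  rank_function rho /\
  forall u v : T, (u < v)%O ->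
    \sum_(z : T | (u <= z)%O && (z <= v)%O) (-1) ^+ rho z = 0 :> int.

(* The passage from f to g for a poset of rank [r >= 1]; the inner [if] is
   the coefficient of index i - 1 of f, which is 0 for i = 0. *)
Definition toric_g_of_f (r : nat) (f : {poly int}) : {poly int} :=
  \poly_(i < ((r - 1)./2).+1) (f`_i - (if i is j.+1 then f`_j else 0)).

(* Since the lower intervals of [\bot, p] are lower intervals of T, the mutual
   recursion defining f and g is run inside T: [toric_f rho p] and
   [toric_g rho p] are f([\bot, p), x) and g([\bot, p), x), computed for the
   poset [\bot, p] of rank [rho p].  The recursion is on fuel bounding the
   number of elements below p; see [toric_gE]. *)
Fixpoint toric_g_rec (d : Order.disp_t) (T : finTBPOrderType d)
    (rho : T -> nat) (fuel : nat) (p : T) : {poly int} :=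
  if fuel is k.+1 then
    if p == \bot%O then 1 else
    toric_g_of_f (rho p)
      (\sum_(q : T | (q < p)%O)
         toric_g_rec rho k q * ('X - 1) ^+ (rho p - 1 - rho q))
  else 1.

Definition toric_g (d : Order.disp_t) (T : finTBPOrderType d)
    (rho : T -> nat) (p : T) : {poly int} :=
  toric_g_rec rho #|[pred q : T | (q < p)%O]| p.

Definition toric_f (d : Order.disp_t) (T : finTBPOrderType d)
    (rho : T -> nat) (p : T) : {poly int} :=
  if p == \bot%O then 1 else
  \sum_(q : T | (q < p)%O) toric_g rho q * ('X - 1) ^+ (rho p - 1 - rho q).

Lemma toric_gE (d : Order.disp_t) (T : finTBPOrderType d)
    (rho : T -> nat) (p : T) :
  toric_g rho p =
    if p == \bot%O then 1 else toric_g_of_f (rho p) (toric_f rho p).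
Proof.
pose c (p : T) := #|[pred q : T | (q < p)%O]|.
have cS (q r : T) : (q < r)%O -> (c q < c r)%N.
  move=> qr; apply: proper_card; apply/properP; split.
    by apply/subsetP => s; rewrite !inE => /lt_trans; apply.
  by exists q; rewrite !inE ?ltxx.
have c0 (q : T) : q != \bot%O -> (0 < c q)%N.
  by rewrite -lt0x => /cS; apply: leq_trans.
have recE k : forall q l, (c q <= k)%N -> (c q <= l)%N ->
    toric_g_rec rho k q = toric_g_rec rho l q.
  elim: k => [|k IH] q [|l] //= hk hl; case: eqP => // /eqP /c0.
  - by rewrite ltnNge hk.
  - by rewrite ltnNge hl.
  move=> _; congr toric_g_of_f; apply: eq_bigr => r /cS rq.
  by congr (_ * _); apply: IH; rewrite -ltnS; apply: leq_trans rq _.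
rewrite /toric_f; case: (eqVneq p \bot%O) => [->|pn].
  by rewrite /toric_g; case: #|_| => //= k; rewrite eqxx.
rewrite /toric_g; case ck: #|_| => [|k] /=; first by move: (c0 p pn); rewrite /c ck.
rewrite (negPf pn); congr toric_g_of_f; apply: eq_bigr => r /cS rp.
by congr (_ * _); apply: recE => //; rewrite -ltnS -ck.
Qed.

(* Terms of nonnegative degree of x^n f(x^-2). *)
Definition short_version (n : nat) (f : {poly int}) : {poly int} :=
  \sum_(i < size f | (i.*2 <= n)%N) f`_i *: 'X^(n - i.*2).

Definition short_toric (d : Order.disp_t) (T : finTBPOrderType d)
    (rho : T -> nat) : {poly int} :=
  short_version (rho \top%O - 1) (toric_f rho \top%O).

(* The other characterization of the short version q of f: q has degree n,
   q(x) = (-1)^n q(-x), and f(x) = x^(n/2) (q(sqrt x) + q(1 / sqrt x) - q(0)),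
   written as f(x^2) = x^n (q(x) + q(1/x) - q(0)) after replacing x by x^2. *)
Definition short_version_spec (n : nat) (f q : {poly int}) : Prop :=
  [/\ size q = n.+1,
      q = (-1) ^+ n *: (q \Po (- 'X)) &
      f \Po 'X^2 =
        'X^n * q + \sum_(i < n.+1) q`_i *: 'X^(n - i) - q.[0] *: 'X^n].

Lemma coef_short_version (n : nat) (f : {poly int}) (j : nat) :
  (short_version n f)`_j =
    if (j <= n)%N && ~~ odd (n - j) then f`_((n - j)./2) else 0.
Proof.
rewrite /short_version coef_sum.
under eq_bigr => i _ do rewrite coefZ coefXn.
case: ifP => [/andP[jn /even_halfK nj]|njN]; last first.
  apply: big1 => i hi; case: eqP => [e|_]; last by rewrite mulr0.
  by move: njN; rewrite e leq_subr subKn // odd_double.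
have [lt|ge] := ltnP (n - j)./2 (size f).
  rewrite (bigD1 (Ordinal lt)) /=; last by rewrite nj leq_subr.
  rewrite nj subKn // eqxx mulr1 big1 ?addr0 // => i /andP[hi /eqP ni].
  case: eqP => [e|_]; last by rewrite mulr0.
  by case: ni; apply: val_inj; rewrite /= e subKn // doubleK.
rewrite nth_default // big1 // => i hi; case: eqP => [e|_]; last by rewrite mulr0.
by move: ge; rewrite e subKn // doubleK leqNgt ltn_ord.
Qed.

Lemma short_version_specP (n : nat) (f q : {poly int}) :
  size f = n.+1 -> (forall i, (i <= n)%N -> f`_(n - i) = f`_i) ->
  short_version_spec n f q <-> q = short_version n f.
Proof.
move=> sf palf.
have coefN (p : {poly int}) j : (p \Po (- 'X))`_j = (-1) ^+ j * p`_j.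
  rewrite comp_polyE coef_sum.
  under eq_bigr => i _ do rewrite exprNn coefZ -polyC1 -polyCN -polyC_exp coefCM coefXn.
  have [lt|ge] := ltnP j (size p).
    rewrite (bigD1 (Ordinal lt)) //= eqxx mulr1 big1 ?addr0 ?(mulrC p`_j) //.
    move=> i ni; case: eqP => [e|_]; last by rewrite !mulr0.
    by move: ni; rewrite -val_eqE /= e eqxx.
  rewrite (nth_default _ ge) mulr0 big1 // => i _; case: eqP => [e|_]; last by rewrite !mulr0.
  by move: ge; rewrite e leqNgt ltn_ord.
have coefR (p : {poly int}) k :
    ('X^n * p + \sum_(i < n.+1) p`_i *: 'X^(n - i) - p.[0] *: 'X^n)`_k =
    if (k < n)%N then p`_(n - k) else p`_(k - n).
  rewrite coefB coefD coefXnM coefZ coefXn coef_sum horner_coef0.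
  under eq_bigr => i _ do rewrite coefZ coefXn.
  have [lt|ge] := leqP k n.
    have lt' : (n - k < n.+1)%N by rewrite ltnS leq_subr.
    rewrite (bigD1 (Ordinal lt')) //= subKn // eqxx mulr1 big1 ?addr0; last first.
      move=> i ni; case: eqP => [e|_]; last by rewrite mulr0.
      by move: ni; rewrite -val_eqE /= e subKn ?eqxx // -ltnS.
    move: lt; rewrite leq_eqVlt => /orP[/eqP->|lt].
      by rewrite eqxx ltnn subnn mulr1 addrK.
    by rewrite lt ltn_eqF // mulr0 subr0 add0r.
  rewrite ltnNge (ltnW ge) /= gtn_eqF // mulr0 subr0 big1 ?addr0 // => i _.
  by case: eqP => [e|_]; [move: ge; rewrite e ltnNge leq_subr | rewrite mulr0].
split=> [[sq parq eqf]|->].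
  apply/polyP => j; rewrite coef_short_version; case: leqP => [jn|nj] /=; last first.
    by rewrite nth_default // sq.
  have := congr1 (fun p : {poly int} => p`_(n - j)) eqf.
  rewrite /= coefR coef_comp_poly_Xn // dvdn2 divn2 subKn //; case: ltnP => [_ ->|nnj ->].
    by [].
  have -> : j = 0%N by case: (j) jn nnj => // j'; case: (n) => // n' _; rewrite subSS ltnNge leq_subr.
  by rewrite subn0 subnn.
have fE := coef_short_version n f.
have lead0 : (short_version n f)`_n = f`_n.
  by rewrite fE leqnn subnn /= -(palf 0%N) // subn0.
have fn0 : f`_n != 0 by rewrite -[n]/(n.+1.-1) -sf -lead_coefE lead_coef_eq0 -size_poly_eq0 sf.
split.
- apply/eqP; rewrite eqn_leq; apply/andP; split.
    by apply/leq_sizeP => j nj; rewrite fE leqNgt nj.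
  by rewrite ltnNge; apply: contra fn0 => /leq_sizeP /(_ n (leqnn _)); rewrite lead0 => ->.
- apply/polyP => j; rewrite coefZ coefN fE; case: ifP; rewrite ?mulr0 //.
  move=> /andP[jn]; rewrite oddB // negb_add => /eqP e.
  by rewrite -signr_odd -(signr_odd _ j) e mulrA -signr_addb addbb mul1r.
apply/polyP => k; rewrite coefR coef_comp_poly_Xn // dvdn2 divn2 !fE leq_subr.
case: ltnP => [kn|nk]; first by rewrite subKn ?(ltnW kn).
have [k2|k2] := leqP (k - n) n; last first.
  case: ifP => // /even_halfK kK; rewrite nth_default // sf.
  by rewrite -ltn_double kK -addnn -ltn_subRL.
rewrite subnBA // addnn oddB; last by rewrite -addnn -leq_subLR.
rewrite odd_double /=; case: ifP => // ko.
rewrite -(palf k./2); last by rewrite -leq_double even_halfK // -addnn -leq_subLR.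
by congr (f`_ _); rewrite -{2}(even_halfK ko) -doubleB doubleK.
Qed.

(* t_m; the Boolean algebra of rank m + 1 is the subsets of an (m + 1)-element
   set ordered by inclusion, with cardinality as its rank function. *)
Definition boolean_short_toric (m : nat) : {poly int} :=
  @short_toric _ {set 'I_m.+1} (fun A => #|A|).

(* Main.v *)
(** Both directions compare coefficients.  With [f] the toric polynomial of
   the poset, the coefficient of x^(n-2i) in the short toric polynomial is
   [x^i]f, while [x^i]g = [x^i]f - [x^(i-1)]f; since t_(n-2k) has coefficient 1
   at x^(n-2i) exactly when k <= i, the first identity says that the partial
   sums of the c_k are the [x^i]f, the second that the c_k are their
   differences.  For the Boolean algebra g = 1 by induction, because
   (x - 1) f = x^r - 1 by the binomial theorem as soon as g = 1 below. *)

Require Import Defs.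
From HB Require Import structures.
From mathcomp Require Import all_boot all_order all_algebra.
From mathcomp Require Import zify.

Set Implicit Arguments.
Unset Strict Implicit.
Unset Printing Implicit Defensive.

Import Order.TTheory GRing.Theory.
Local Open Scope ring_scope.

(** Grouping the subsets of [A] by cardinality gives the binomial expansion. *)
Lemma sum_subsets_expr (R : comNzRingType) (I : finType) (A : {set I}) (y : R) :
  \sum_(B : {set I} | B \subset A) y ^+ (#|A| - #|B|) = (y + 1) ^+ #|A|.
Proof.
rewrite exprDn (partition_big (fun B : {set I} => inord #|B| : 'I_#|A|.+1) xpredT) //=.
apply: eq_bigr => k _; rewrite expr1n mulr1.
rewrite (eq_bigl [in [set B : {set I} | B \subset A & #|B| == k]]); last first.
  move=> B; rewrite !inE; case BA: (B \subset A) => //=.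
  by rewrite -val_eqE /= inordK // ltnS subset_leq_card.
rewrite -cards_draws -sumr_const; apply: eq_bigr => B.
by rewrite inE => /andP[_ /eqP ->].
Qed.

(** Multiplication by ['X - 1] raises every exponent to [#|A| - #|B|]; only the term [B = A], equal
    to 1, is then missing from the binomial sum for ['X ^+ #|A|]. *)
Lemma sum_proper_subsets_expr (R : idomainType) (I : finType) (A : {set I}) :
  \sum_(B : {set I} | B \proper A) ('X - 1 : {poly R}) ^+ (#|A| - 1 - #|B|) =
  \sum_(i < #|A|) 'X^i.
Proof.
have X1 : ('X - 1 : {poly R}) != 0 by rewrite -polyC1 polyXsubC_eq0.
apply: (mulfI X1); rewrite -subrX1 -[X in X ^+ _ - _](subrK (1 : {poly R})).
rewrite -sum_subsets_expr [in RHS](bigD1 A) //= subnn addrAC subrr add0r mulr_sumr.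
apply: eq_big => B; first by rewrite properEneq andbC.
move=> /proper_card BA.
by rewrite -exprS subnAC -subSn ?subn_gt0 // subn1.
Qed.

Lemma coef_geometric (R : nzRingType) (r j : nat) :
  (\sum_(i < r) 'X^i : {poly R})`_j = (j < r)%:R.
Proof.
under eq_bigr do rewrite -['X^_]scale1r.
by rewrite -(poly_def r (fun=> 1)) coef_poly; case: ifP.
Qed.

(** Equal consecutive coefficients cancel; the truncation at [(r - 1)./2] stops before index [r],
    where the difference would be -1. *)
Lemma toric_g_of_f_geometric (r : nat) :
  (0 < r)%N -> toric_g_of_f r (\sum_(i < r) 'X^i) = 1.
Proof.
move=> r0; apply/polyP => i; rewrite coef_poly coef1.
case: i => [|i]; first by rewrite coef_geometric r0 subr0.
case: ltnP => // ir; rewrite !coef_geometric.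
have {}ir : (i.+1 < r)%N by lia.
by rewrite ir (ltnW ir) subrr.
Qed.

Section Boolean.
Import Order.DefaultSetSubsetOrder.

Lemma lt_set_proper (I : finType) (A B : {set I}) : (A < B)%O = (A \proper B).
Proof. by rewrite lt_neqAle properEneq; congr (_ && _); exact: leEsubset. Qed.

Lemma toric_g_subsets (I : finType) (A : {set I}) :
  toric_g (fun B : {set I} => #|B|) A = 1.
Proof.
(* Strong induction on the cardinality of [A]. *)
elim: {A}_.+1 {-2}A (ltnSn #|A|) => // k IH A; rewrite ltnS => Ak.
rewrite toric_gE /toric_f; case: eqVneq => // A0.
rewrite (_ : \sum_(_ | _) _ = \sum_(i < #|A|) 'X^i).
  by rewrite toric_g_of_f_geometric // card_gt0.
rewrite -sum_proper_subsets_expr; apply: eq_big => B; first exact: lt_set_proper.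
rewrite lt_set_proper => BA.
by rewrite IH ?mul1r // (leq_trans _ Ak) // proper_card.
Qed.

Lemma toric_f_subsets (I : finType) (A : {set I}) :
  A != set0 -> toric_f (fun B : {set I} => #|B|) A = \sum_(i < #|A|) 'X^i.
Proof.
move=> A0; rewrite /toric_f (negPf A0 : (A == \bot%O) = false).
rewrite -sum_proper_subsets_expr.
by apply: eq_big => B; rewrite ?lt_set_proper // toric_g_subsets mul1r.
Qed.

Lemma coef_boolean_short_toric (m j : nat) :
  (boolean_short_toric m)`_j = ((j <= m)%N && ~~ odd (m - j))%:R.
Proof.
have cT : #|[set: 'I_m.+1]| = m.+1 by rewrite cardsT card_ord.
have topE : \top%O = [set: 'I_m.+1] by [].
rewrite /boolean_short_toric /short_toric coef_short_version topE.
rewrite toric_f_subsets -?card_gt0 cT // subn1 /=.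
by case: ifP => //= _; rewrite coef_geometric; have -> : ((m - j)./2 < m.+1)%N by lia.
Qed.

End Boolean.

Lemma coef_sum_boolean_short_toric (n : nat) (c : nat -> int) (j : nat) :
  (\sum_(k < (n./2).+1) c k *: boolean_short_toric (n - k.*2))`_j =
  if (j <= n)%N && ~~ odd (n - j)
  then \sum_(k < ((n - j)./2).+1) c k else 0.
Proof.
rewrite coef_sum; under eq_bigr do rewrite coefZ coef_boolean_short_toric.
case: ifP => [nj|nj]; last first.
  (* As [k <= n./2], the subtraction [n - k.*2] is exact, so a nonzero coefficient at [j] would
     force [j <= n] and [n - j] even. *)
  apply: big1 => k _; have := ltn_ord k.
  case: andP => [[]|]; rewrite ?mulr0 //.
  lia.
(* Both sums now run over [k <= n./2], the right one restricted to [k <= (n - j)./2]. *)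
rewrite (big_ord_widen (n./2).+1); last by lia.
rewrite [RHS]big_mkcond; apply: eq_bigr => k _; have := ltn_ord k => kn.
have -> : ((j <= n - k.*2)%N && ~~ odd (n - k.*2 - j)) = (k < ((n - j)./2).+1)%N by lia.
by case: ifP => _; rewrite ?mulr1 ?mulr0.
Qed.

Lemma partial_sums_iff_differences (V : zmodType) (u c : nat -> V) (N : nat) :
  (forall i, (i < N)%N -> u i = \sum_(k < i.+1) c k) <->
  (forall i, (i < N)%N -> u i - (if i is j.+1 then u j else 0) = c i).
Proof.
split=> [uE [|i] iN|cE].
- by rewrite uE // big_ord1 subr0.
- by rewrite !uE ?(ltnW iN) // big_ord_recr /= addrAC subrr add0r.
elim=> [|i IH] iN; rewrite big_ord_recr /=.
  by rewrite big_ord0 add0r -cE // subr0.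
by rewrite -IH ?(ltnW iN) // -cE // addrC subrK.
Qed.

Theorem proposition5p4 (d : Order.disp_t) (T : finTBPOrderType d)
    (rho : T -> nat) (n : nat) (c : 'I_(n./2).+1 -> int) :
  eulerian rho -> rho \top%O = n.+1 ->
  (short_toric rho =
     \sum_(k < (n./2).+1) c k *: boolean_short_toric (n - k.*2))
  <->
  (toric_g rho \top%O = \sum_(k < (n./2).+1) c k *: 'X^k).
Proof.
(* Extending [c] to all naturals allows partial sums over shorter ranges. *)
move=> [[rho0 _] _] rho1; pose c' k := c (inord k).
have cE (F : nat -> {poly int}) :
    \sum_(k < (n./2).+1) c k *: F k = \sum_(k < (n./2).+1) c' k *: F k.
  by apply: eq_bigr => k _; rewrite /c' inord_val.
rewrite (cE (fun k => boolean_short_toric (n - k.*2))) (cE (fun k => 'X^k)).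
have topN0 : (\top%O == \bot%O :> T) = false.
  by apply/eqP => top0; move: rho1; rewrite top0 rho0.
rewrite toric_gE topN0 rho1 /short_toric rho1 subn1 /= -poly_def.
set f := toric_f rho \top%O.
(* Both sides vanish at [j] unless [j = n - i.*2] with [i <= n./2], and there the coefficient on the
   left is that of [f] at [i]. *)
have shortE : short_version n f =
    \sum_(k < (n./2).+1) c' k *: boolean_short_toric (n - k.*2) <->
    (forall i, (i < (n./2).+1)%N -> f`_i = \sum_(k < i.+1) c' k).
  split=> [/polyP fE i iN|fE]; last first.
    apply/polyP => j; rewrite coef_short_version coef_sum_boolean_short_toric.
    by case: ifP => // nj; apply: fE; lia.
  have := fE (n - i.*2)%N.
  rewrite coef_short_version coef_sum_boolean_short_toric.
  have -> : (n - (n - i.*2))%N = i.*2 by lia.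
  by rewrite leq_subr odd_double doubleK.
(* For rank [n.+1] the truncation bound of [g] is [n./2], exactly the range of the [c' k]. *)
rewrite shortE partial_sums_iff_differences /toric_g_of_f subn1 /=.
split=> [gE|/polyP gE i iN]; first by apply/polyP => i; rewrite !coef_poly; case: ifP => // /gE.
by have := gE i; rewrite !coef_poly iN.
Qed.
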